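(* Let $\omega\in\Omega_0^*\cup\Omega_1^*$. Then $$\gamma_{\tilde G_\omega}(n)\preceq\exp\left(\frac{n\log(\log n)}{\log n}\right).$$
   Context: Let $T_2$ be the infinite binary rooted tree whose vertices are the finite words over $\{0,1\}$ (the root is the empty word, the children of $v$ are $v0$ and $v1$). Let $P$ denote the action at a vertex $v$ that interchanges the two subtrees rooted at $v0$ and $v1$ (sending $v0w\mapsto v1w$ and $v1w\mapsto v0w$), and let $I$ denote the trivial action. A sequence $(a_n)_{n\ge1}$ with $a_n\in\{P,I\}$ is identified with the automorphism of $T_2$ that acts as $a_n$ at the vertex $1^{n-1}0$ for each $n\ge1$ and trivially at all other vertices. Let $a\in\mathrm{Aut}(T_2)$ act as $P$ at the root and trivially at all other vertices, and let $x$ be the automorphism given by the constant sequence $(P,P,P,\dots)$. For $\omega=\omega_1\omega_2\cdots\in\Omega=\{0,1,2\}^{\mathbb N}$ let $b_\omega,c_\omega,d_\omega$ be the automorphisms given by the sequences $(b_n),(c_n),(d_n)$, where $b_n=I$ if $\omega_n=2$ and $b_n=P$ otherwise; $c_n=I$ if $\omega_n=1$ and $c_n=P$ otherwise; $d_n=I$ if $\omega_n=0$ and $d_n=P$ otherwise. The generalized Grigorchuk overgroup $\tilde G_\omega$ is the subgroup of $\mathrm{Aut}(T_2)$ generated by $a,b_\omega,c_\omega,d_\omega,x$. Subsets of $\Omega$: $\Omega_0$ is the set of sequences containing each of $0,1,2$ infinitely often; $\Omega_2$ is the set of eventually constant sequences; $\Omega_1=\Omega\setminus(\Omega_0\cup\Omega_2)$.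 $\Omega_0^*\subset\Omega_0$ is the set of $\omega\in\Omega_0$ for which there is an integer $M=M(\omega)$ such that for all $k\ge1$ the set $\{\omega_k,\omega_{k+1},\dots,\omega_{k+M-1}\}$ contains all three symbols. $\Omega_1^*\subset\Omega_1$ is the set of $\omega\in\Omega_1$ for which there is an integer $M=M(\omega)$ such that for all $k\ge1$ the set $\{\omega_k,\dots,\omega_{k+M-1}\}$ contains at least two symbols. For a group $G$ with finite generating set $S$, $\gamma_{G,S}(n)$ is the number of elements of $G$ that can be written as a product of at most $n$ generators from $S$; write $\gamma_{\tilde G_\omega}$ for $\gamma_{\tilde G_\omega,\tilde S_\omega}$ with $\tilde S_\omega=\{a,b_\omega,c_\omega,d_\omega,x,xb_\omega,xc_\omega,xd_\omega\}$ (the assertion does not depend on the choice of finite generating set). For functions $f,g$, $f\preceq g$ means that there are positive constants $A,B$ such that $f(n)\le A\,g(Bn)$ for all sufficiently large $n$. *)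

(* Defs.v *)
From HB Require Import structures.
From mathcomp Require Import all_boot all_order all_algebra.
From mathcomp Require Import finmap.
From mathcomp Require Import boolp classical_sets functions cardinality.
From mathcomp Require Import reals topology normedtype sequences exp.

Import GRing.Theory Num.Theory.

Set Implicit Arguments.
Unset Strict Implicit.
Unset Printing Implicit Defensive.

Local Open Scope classical_set_scope.

(* Vertices are written from the root downwards, with false for the letter 0   *)
(* and true for the letter 1; the children of v are rcons v false and          *)
(* rcons v true.                                                               *)
Definition vertex : Type := seq bool.

Definition child (u v : vertex) : Prop := exists i, v = rcons u i.
Definition adjacent (u v : vertex) : Prop := child u v \/ child v u.

Definition tree_automorphism (f : vertex -> vertex) : Prop :=
  [/\ bijective f, f [::] = [::]
    & forall u v, adjacent u v <-> adjacent (f u) (f v)].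

Record AutT2 := MkAutT2 {
  aut_fun :> vertex -> vertex;
  autP : `[< tree_automorphism aut_fun >] }.

HB.instance Definition _ := [isSub for aut_fun].
HB.instance Definition _ := [Choice of AutT2 by <:].

Lemma aut_eqP (f g : AutT2) : (f : vertex -> vertex) =1 g -> f = g.
Proof. by move=> fg; apply/val_inj/funext. Qed.

Lemma tree_automorphism_id : tree_automorphism id.
Proof. by split=> //; exists id. Qed.

Lemma tree_automorphism_comp f g :
  tree_automorphism f -> tree_automorphism g -> tree_automorphism (f \o g).
Proof.
move=> [bf f0 fE] [bg g0 gE]; split; first exact: bij_comp.
  by rewrite /= g0.
by move=> u v; rewrite gE fE.
Qed.

Lemma aut_inverse (f : AutT2) :
  exists g : AutT2, cancel f g /\ cancel g f.
Proof.
have /asboolP [[g fK gK] f0 fE] := autP f.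
have gP : `[< tree_automorphism g >].
  apply/asboolP; split; first by exists f.
    by rewrite -[in LHS]f0 fK.
  by move=> u v; rewrite (fE (g u)) !gK.
by exists (MkAutT2 gP).
Qed.

Definition aut_one : AutT2 := MkAutT2 (asboolT tree_automorphism_id).

Definition aut_mul (f g : AutT2) : AutT2 :=
  MkAutT2 (asboolT (tree_automorphism_comp (asboolW (autP f))
                                           (asboolW (autP g)))).

Definition aut_inv (f : AutT2) : AutT2 := projT1 (cid (aut_inverse f)).

Lemma aut_mulA : associative aut_mul.
Proof. by move=> f g h; apply: aut_eqP. Qed.

Lemma aut_mul1 : left_id aut_one aut_mul.
Proof. by move=> f; apply: aut_eqP. Qed.

Lemma aut_mulr1 : right_id aut_one aut_mul.
Proof. by move=> f; apply: aut_eqP. Qed.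

Lemma aut_mulV : left_inverse aut_one aut_inv aut_mul.
Proof.
by move=> f; apply: aut_eqP => v /=; rewrite /aut_inv; case: cid => g /= [].
Qed.

Lemma aut_mulrV : right_inverse aut_one aut_inv aut_mul.
Proof.
by move=> f; apply: aut_eqP => v /=; rewrite /aut_inv; case: cid => g /= [].
Qed.

HB.instance Definition _ := isGroup.Build AutT2
  aut_mulA aut_mul1 aut_mulr1 aut_mulV aut_mulrV.

(* The automorphism acting at each vertex v as P if p v = true and as I if     *)
(* p v = false: see portrait_fun_rcons.                                        *)
Fixpoint portrait_fun (p : vertex -> bool) (v : vertex) : vertex :=
  if v is i :: w then (i (+) p [::]) :: portrait_fun (fun u => p (i :: u)) w
  else [::].

Lemma portrait_fun_rcons p v i :
  portrait_fun p (rcons v i) = rcons (portrait_fun p v) (i (+) p v).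
Proof. by elim: v p => //= j v IH p; rewrite IH. Qed.

Fixpoint portrait_inv (p : vertex -> bool) (v : vertex) : vertex :=
  if v is j :: w then
    (j (+) p [::]) :: portrait_inv (fun u => p ((j (+) p [::]) :: u)) w
  else [::].

Lemma portrait_funK p : cancel (portrait_fun p) (portrait_inv p).
Proof. by move=> v; elim: v p => //= i v IH p; rewrite addbK IH. Qed.

Lemma portrait_invK p : cancel (portrait_inv p) (portrait_fun p).
Proof. by move=> v; elim: v p => //= i v IH p; rewrite addbK IH. Qed.

Lemma portrait_child p u v :
  child u v <-> child (portrait_fun p u) (portrait_fun p v).
Proof.
split=> [[i ->]|[j]]; first by exists (i (+) p u); rewrite portrait_fun_rcons.
case/lastP: v => [|v i]; first by move/(congr1 size); rewrite size_rcons.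
rewrite portrait_fun_rcons => /rcons_inj [uv _].
by exists i; rewrite (can_inj (portrait_funK p) uv).
Qed.

Lemma portraitP p : tree_automorphism (portrait_fun p).
Proof.
split=> //; first by exists (portrait_inv p);
  [exact: portrait_funK | exact: portrait_invK].
by move=> u v; rewrite /adjacent -!portrait_child.
Qed.

Definition portrait (p : vertex -> bool) : AutT2 :=
  MkAutT2 (asboolT (portraitP p)).

(* Sequences (a_n)_(n >= 1) are indexed from 0 here: s n stands for a_(n+1),   *)
(* with true for P and false for I, and acts at the vertex 1^n 0.              *)
Definition spine_vertex (n : nat) : vertex := rcons (nseq n true) false.

Definition spine_aut (s : nat -> bool) : AutT2 :=
  portrait (fun v => (v == spine_vertex (size v).-1) && s (size v).-1).

Lemma spine_aut_rcons s v i :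
  spine_aut s (rcons v i) = rcons (spine_aut s v)
    (i (+) ((v == spine_vertex (size v).-1) && s (size v).-1)).
Proof. exact: portrait_fun_rcons. Qed.

(* omega n stands for the letter omega_(n+1). *)
Definition Omega : Type := nat -> 'I_3.

Definition gen_a : AutT2 := portrait (fun v => v == [::]).
Definition gen_x : AutT2 := spine_aut (fun _ => true).
Definition gen_b (omega : Omega) : AutT2 :=
  spine_aut (fun n => omega n != 2 :> nat).
Definition gen_c (omega : Omega) : AutT2 :=
  spine_aut (fun n => omega n != 1 :> nat).
Definition gen_d (omega : Omega) : AutT2 :=
  spine_aut (fun n => omega n != 0 :> nat).

Definition Omega0 : set Omega :=
  [set omega | forall s N, exists2 n, (N <= n)%N & omega n = s].
Definition Omega2 : set Omega :=
  [set omega | exists s N, forall n, (N <= n)%N -> omega n = s].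
Definition Omega1 : set Omega := ~` (Omega0 `|` Omega2).

Definition window (omega : Omega) (k M : nat) : {set 'I_3} :=
  [set omega (k + i)%N | i : 'I_M]%SET.

Definition Omega0_star : set Omega :=
  Omega0 `&` [set omega | exists M, forall k, window omega k M = [set: 'I_3]%SET].
Definition Omega1_star : set Omega :=
  Omega1 `&` [set omega | exists M, forall k, (2 <= #|window omega k M|)%N].

Section Growth.
Variable G : groupType.
Implicit Types (H S : set G) (n : nat).

Definition subgroup H : Prop :=
  [/\ H 1%g, forall g h, H g -> H h -> H (g * h)%g & forall g, H g -> H g^-1%g].

Definition generated S : set G := smallest subgroup S.

Definition products S n : set G :=
  [set g | exists s : seq G,
    [/\ (size s <= n)%N, {in s, forall h, S h} & g = (\prod_(h <- s) h)%g]].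

(* H is the group and S its generating set; fset_set is the finite set with    *)
(* the same elements when S is finite, see finite_products.                    *)
Definition growth H S n : nat := #|` fset_set (H `&` products S n)|.

Lemma finite_products S n : finite_set S -> finite_set (products S n).
Proof.
move=> Sfin; elim: n => [|n IH].
  apply: (@sub_finite_set _ _ [set 1%g]); last exact: finite_set1.
  by move=> g [[|h s] [sz _ ->]] //; rewrite big_nil.
apply: (@sub_finite_set _ _ ([set 1%g] `|`
    [set (u.1 * u.2)%g | u in S `*` products S n])); last first.
  by rewrite finite_setU; split; [exact: finite_set1 |
    apply: finite_image; exact: finite_setX].
move=> g [[|h s] [sn sS ->]]; first by left; rewrite big_nil.
right; exists (h, \prod_(k <- s) k)%g; last by rewrite big_cons.
split => /=; first by apply: sS; rewrite mem_head.
by exists s; split=> // k ks; apply: sS; rewrite inE ks orbT.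
Qed.

Lemma products_generated S n : products S n `<=` generated S.
Proof.
move=> g [s [_ sS ->]] H /= [[H1 HM HV] SH].
rewrite big_seq; elim/big_ind: _ => //.
by move=> h hs; apply/SH/sS.
Qed.
End Growth.

Definition overgroup (omega : Omega) : set AutT2 :=
  generated [set g | g \in [:: gen_a; gen_b omega; gen_c omega; gen_d omega;
                               gen_x]].

Definition overgroup_gens (omega : Omega) : set AutT2 :=
  [set g | g \in [:: gen_a; gen_b omega; gen_c omega; gen_d omega; gen_x;
     (gen_x * gen_b omega)%g; (gen_x * gen_c omega)%g; (gen_x * gen_d omega)%g]].

Lemma finite_overgroup_gens omega : finite_set (overgroup_gens omega).
Proof. exact: finite_seq. Qed.

Lemma generated_overgroup_gens omega :
  generated (overgroup_gens omega) = overgroup omega.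
Proof.
apply/seteqP; split=> g gG H /= [[H1 HM HV] SH]; apply: gG; split=> // h /=.
  have Hm k : k \in [:: gen_a; gen_b omega; gen_c omega; gen_d omega; gen_x] ->
    H k by exact: SH.
  have [Ha Hb Hc Hd] : [/\ H gen_a, H (gen_b omega), H (gen_c omega)
      & H (gen_d omega)] by split; apply: Hm; rewrite !inE eqxx ?orbT.
  have Hx : H gen_x by apply: Hm; rewrite !inE eqxx ?orbT.
  rewrite /overgroup_gens /= !inE.
  by move=> /or4P[|||/or4P[||| /orP[]]] /eqP -> //; apply: HM.
move=> hS; apply: SH; move: hS; rewrite /overgroup_gens /= !inE.
by move=> /or4P[|||/orP[]] /eqP ->; rewrite eqxx ?orbT.
Qed.

Definition preceq (R : realType) (f : nat -> R) (g : R -> R) : Prop :=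
  exists A B : R, [/\ (0 < A)%R, (0 < B)%R &
    \forall n \near \oo, (f n <= A * g (B * n%:R))%R].

(* Main.v *)
Require Import Defs.
From mathcomp Require Import all_boot all_order all_algebra.
From mathcomp Require Import finmap zify ring lra.
From mathcomp Require Import boolp classical_sets functions cardinality.
From mathcomp Require Import reals topology normedtype sequences exp.

Set Implicit Arguments.
Unset Strict Implicit.
Unset Printing Implicit Defensive.

(* An element of length n is a word y_0 a y_1 a ... a y_k whose letters y_i    *)
(* are functions 'I_3 -> bool, y acting as P at the n-th spine vertex iff      *)
(* y (omega n) holds. The letters y with y (omega 0) = true are exactly those  *)
(* leaving an a in a section, so passing to the sections erases one letter     *)
(* for every y with y (omega 0) = false, up to 2 ^ k new letters at level k.   *)
(* Every letter other than x (up to letters acting like x on all symbols that  *)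
(* still occur) is erased, or merged next to an erasure, within M levels.      *)
(* Erasures over all levels up to about (log n) / 2 total O(n), so at some     *)
(* such level j the 2 ^ j sections together contain only O(n / log n) letters  *)
(* different from x. Recording that level and the permutations above it        *)
(* determines the element; giving x the weight K ~ log n and other symbols     *)
(* weight 1, there are at most exp (O(n log log n / log n)) such records.      *)

(** Passing to the two sections loses exactly the letters vanishing at the current symbol, up to two
    boundary letters ([size_sections]), so erasures over [J] levels total at most the length plus
    [2 ^ J.+1] ([nletters_sum]). A letter vanishing at [i] disappears only at the cost of an erasure
    ([zeros_sections]), and [i] recurs within [M] levels; hence the erasures in a block of [M]
    levels control the letters not acting like [x] at its start ([nzeros_window]). One of [K]
    consecutive blocks has O(n / K) erasures ([sparse_code]). The code at its first level determines
    the automorphism ([code_inj]), and the weighted count [card_sparse_ffun] of such sparse codes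
    bounds the ball by exp(O(n log K / K)) ([growth_le], [growth_le_expR]). With [K] of order log n
    this is the claim. *)

Definition letter : finType := {ffun 'I_3 -> bool}.

Definition letter0 : letter := [ffun => false].
Definition letter1 : letter := [ffun => true].
Definition letterD (y z : letter) : letter := [ffun i => y i (+) z i].

Definition spine (omega : Omega) (y : letter) : AutT2 :=
  spine_aut (fun n => y (omega n)).

Definition oshift (omega : Omega) : Omega := fun n => omega n.+1.

Lemma eq_portrait_fun p q : p =1 q -> portrait_fun p =1 portrait_fun q.
Proof.
move=> pq v; elim: v p q pq => //= i v IH p q pq.
by rewrite pq; congr (_ :: _); apply: IH => u; apply: pq.
Qed.

Lemma portrait_fun0 p : p =1 (fun=> false) -> portrait_fun p =1 id.
Proof.
move=> p0 v; rewrite (eq_portrait_fun p0); elim: v {p p0} => //= i v ->.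
by rewrite addbF.
Qed.

Lemma gen_a_cons i v : gen_a (i :: v) = ~~ i :: v.
Proof. by rewrite /= portrait_fun0 // addbT. Qed.

Lemma gen_aK v : gen_a (gen_a v) = v.
Proof. by case: v => // i v; rewrite !gen_a_cons negbK. Qed.

Lemma spine_true omega y v :
  spine omega y (true :: v) = true :: spine (oshift omega) y v.
Proof.
rewrite /=; congr (_ :: _); apply: eq_portrait_fun => u.
by case: u => //= j u; rewrite /spine_vertex /= eqseq_cons eqxx.
Qed.

Lemma spine_false omega y v :
  spine omega y (false :: v) =
    false :: (if y (omega 0) then gen_a v else v).
Proof.
rewrite /=; congr (_ :: _).
case: ifP => y0; last by rewrite portrait_fun0 // => -[|j u] /=; rewrite ?y0 ?andbF //.
by apply: eq_portrait_fun => -[|j u] /=; rewrite ?y0.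
Qed.

Lemma spineD omega y z :
  spine omega (letterD y z) = (spine omega y * spine omega z)%g.
Proof.
apply: aut_eqP => v.
change (spine omega (letterD y z) v = spine omega y (spine omega z v)).
elim: v omega => [|[] v IH] omega //; first by rewrite !spine_true IH.
rewrite !spine_false ffunE; case: (z _); case: (y _) => //.
by rewrite addbb gen_aK.
Qed.

Lemma spine0 omega : spine omega letter0 = 1%g.
Proof.
apply: aut_eqP => v; rewrite [RHS]/=.
elim: v omega => [|[] v IH] omega //; first by rewrite spine_true IH.
by rewrite spine_false ffunE.
Qed.

(** * Words and their sections *)

(* The word (h, [:: y1; ...; yk]) stands for yk a ... a y1 a h. *)
Definition word : Type := letter * seq letter.
Definition letters (w : word) : seq letter := w.1 :: w.2.

Implicit Types (S : {set 'I_3}) (omega : Omega) (w : word).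

Fixpoint word_aut_rec (omega : Omega) (h : letter) (t : seq letter) : AutT2 :=
  if t is y :: t' then (word_aut_rec omega y t' * gen_a * spine omega h)%g
  else spine omega h.
Definition word_aut omega (w : word) := word_aut_rec omega w.1 w.2.

Definition mul_letter (w : word) (y : letter) : word := (letterD w.1 y, w.2).
(** A word ends in a letter on the right, so appending [a] opens a fresh trivial letter. *)
Definition mul_a (b : bool) (w : word) : word :=
  if b then (letter0, letters w) else w.

Lemma word_aut_mul_letter omega w y :
  word_aut omega (mul_letter w y) = (word_aut omega w * spine omega y)%g.
Proof. by case: w => h [|z t]; rewrite /word_aut /= spineD ?mulgA. Qed.

Lemma word_aut_mul_a omega b w :
  word_aut omega (mul_a b w) = if b then (word_aut omega w * gen_a)%g else word_aut omega w.
Proof. by case: b => //=; rewrite /word_aut /= spine0 mulg1. Qed.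

Lemma word_aut1 omega : word_aut omega (letter0, [::]) = 1%g.
Proof. exact: spine0. Qed.

(** The rightmost letter [h] acts first, as a power of [a] on subtree 0 and as [h] on subtree 1; the
    next [a] exchanges the subtrees, hence the crossing of [l] and [r]. *)
Fixpoint sections_rec (s : 'I_3) (h : letter) (t : seq letter) : word * word :=
  if t is y :: t' then
    let: (l, r) := sections_rec s y t' in (mul_a (h s) r, mul_letter l h)
  else (mul_a (h s) (letter0, [::]), (h, [::])).
Definition sections s (w : word) := sections_rec s w.1 w.2.
Definition root_swap (w : word) : bool := odd (size w.2).

Lemma word_aut_cons omega w i v :
  word_aut omega w (i :: v) = (i (+) root_swap w) ::
    word_aut (oshift omega)
      (if i then (sections (omega 0) w).2 else (sections (omega 0) w).1) v.
Proof.
case: w => h t; rewrite /root_swap /sections /=.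
elim: t h i v => [|y t IH] h i v.
  rewrite /word_aut; case: i; first by rewrite spine_true.
  by rewrite spine_false -/(word_aut _ _) word_aut_mul_a word_aut1; case: (h _).
rewrite [LHS]/=.
change (word_aut omega (y, t) (gen_a (spine omega h (i :: v))) =
 (i (+) odd (size t).+1) :: word_aut (oshift omega)
   (if i then (sections_rec (omega 0) h (y :: t)).2
    else (sections_rec (omega 0) h (y :: t)).1) v).
case: i; rewrite ?spine_true ?spine_false gen_a_cons IH /=;
  case: (sections_rec _ _ _) => l r /=.
  by rewrite word_aut_mul_letter negbK.
by rewrite word_aut_mul_a; case: (h _).
Qed.

(** * Erased letters, level by level *)

Definition zeros (s : 'I_3) (w : word) := count (fun y : letter => ~~ y s) (letters w).

(** Each letter merges into one section and, if it holds at [s], opens a fresh letter in the other;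
    the 2 counts the letter each section starts with. *)
Lemma size_sections s w :
  size (letters (sections s w).1) + size (letters (sections s w).2) + zeros s w
    = size (letters w) + 2.
Proof.
case: w => h t; rewrite /sections /zeros /=.
elim: t h => [|y t IH] h /=; first by case: (h s).
have := IH y; case: (sections_rec s y t) => -[hl l] [hr r] /=.
by case: (h s) => /=; lia.
Qed.

(** A fresh letter is trivial, so it counts as a zero at [i]; absorbing [h] changes the value at [i]
    of one head letter, and only when [h i] holds. If [h s] fails, the missing fresh zero is paid
    for by [zeros s w]. *)
Lemma zeros_sections s i w :
  zeros i w + 2 <= zeros i (sections s w).1 + zeros i (sections s w).2 + zeros s w.
Proof.
case: w => h t; rewrite /sections /zeros /=.
elim: t h => [|y t IH] h /=; first by case: (h s); rewrite /= !ffunE; case: (h i).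
have := IH y; case: (sections_rec s y t) => -[hl l] [hr r] /=.
by case: (h s) => /=; rewrite !ffunE; case: (h i); case: (hl i) => /=; lia.
Qed.

Fixpoint level (k : nat) (omega : Omega) (w : word) : seq word :=
  if k is k'.+1 then
    level k' (oshift omega) (sections (omega 0) w).1 ++
    level k' (oshift omega) (sections (omega 0) w).2
  else [:: w].

Lemma big_levelS (F : word -> nat) k omega w :
  \sum_(u <- level k.+1 omega w) F u =
    \sum_(u <- level k (oshift omega) (sections (omega 0) w).1) F u +
    \sum_(u <- level k (oshift omega) (sections (omega 0) w).2) F u.
Proof. by rewrite /= big_cat. Qed.

Definition nletters k omega w := \sum_(u <- level k omega w) size (letters u).
Definition nzeros i k omega w := \sum_(u <- level k omega w) zeros i u.

Lemma nlettersS k omega w :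
  nletters k.+1 omega w + nzeros (omega k) k omega w = nletters k omega w + 2 ^ k.+1.
Proof.
rewrite /nletters /nzeros; elim: k omega w => [|k IH] omega w.
  by rewrite /= !big_cons !big_nil !addn0 size_sections.
rewrite -[omega k.+1]/(oshift omega k) !(big_levelS _ k.+1) !(big_levelS _ k omega).
have := IH (oshift omega) (sections (omega 0) w).1.
have := IH (oshift omega) (sections (omega 0) w).2.
rewrite [2 ^ k.+2]expnS; lia.
Qed.

Lemma nzerosS i k omega w :
  nzeros i k omega w <= nzeros i k.+1 omega w + nzeros (omega k) k omega w.
Proof.
rewrite /nzeros; elim: k omega w => [|k IH] omega w.
  by rewrite /= !big_cons !big_nil !addn0; have := zeros_sections (omega 0) i w; lia.
rewrite -[omega k.+1]/(oshift omega k) !(big_levelS _ k.+1) !(big_levelS _ k omega).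
have := IH (oshift omega) (sections (omega 0) w).1.
have := IH (oshift omega) (sections (omega 0) w).2.
lia.
Qed.

Definition nerased k omega w := nzeros (omega k) k omega w.

Lemma nletters_sum k omega w :
  nletters k omega w + \sum_(0 <= j < k) nerased j omega w + 2
    = size (letters w) + 2 ^ k.+1.
Proof.
elim: k => [|k IH]; first by rewrite big_geq // /nletters big_cons big_nil; lia.
move: IH; rewrite big_nat_recr //=; have := nlettersS k omega w.
by rewrite -/(nerased _ _ _) [2 ^ k.+2]expnS; lia.
Qed.

Lemma nzeros_sum i k m omega w :
  nzeros i k omega w <= nzeros i (k + m) omega w
    + \sum_(k <= j < k + m) nerased j omega w.
Proof.
elim: m => [|m IH]; first by rewrite addn0 big_geq // addn0.
rewrite addnS big_nat_recr ?leq_addr //=.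
by have := nzerosS i (k + m) omega w; rewrite -/(nerased _ _ _); lia.
Qed.

(** Zeros at [i] persist except for what erasures absorb, and at a level whose symbol is [i] they
    are themselves the erased letters. *)
Lemma nzeros_window i k M omega w : i \in window omega k M ->
  nzeros i k omega w <= \sum_(k <= j < k + M) nerased j omega w.
Proof.
case/imsetP => j _ ->.
apply: (leq_trans (nzeros_sum _ _ j _ _)).
rewrite -/(nerased _ _ _) addnC -big_nat_recr ?leq_addr //=.
rewrite [leqRHS](big_cat_nat (n := (k + j).+1)) //=; first exact: leq_addr.
  by rewrite -addnS leq_addr.
by rewrite -addnS leq_add2l.
Qed.

(** * Codes recording root swaps down to a level and the words there *)

(** When only symbols of [S] still occur, a letter true on [S] acts as [x]; rewriting it as
    [letter1] makes it blank in the code. *)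
Definition canon S (y : letter) : letter :=
  if [forall (i | i \in S), y i] then letter1 else y.

Lemma spine_canon S omega y : (forall n, omega n \in S) ->
  spine omega (canon S y) = spine omega y.
Proof.
rewrite /canon => omegaS; case: ifP => // /forallP y1.
congr spine_aut; apply: funext => n.
by rewrite ffunE; move/implyP: (y1 (omega n)) => ->.
Qed.

Lemma word_aut_canon S omega w : (forall n, omega n \in S) ->
  word_aut omega (canon S w.1, map (canon S) w.2) = word_aut omega w.
Proof.
move=> omegaS; case: w => h t; rewrite /word_aut /=.
by elim: t h => [|y t IH] h /=; rewrite ?IH spine_canon.
Qed.

Lemma eq_word_aut_canon S omega w w' : (forall n, omega n \in S) ->
  map (canon S) (letters w) = map (canon S) (letters w') ->
  word_aut omega w = word_aut omega w'.
Proof.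
move=> omegaS [eq1 eq2].
by rewrite -(word_aut_canon w omegaS) eq1 eq2 word_aut_canon.
Qed.

(* None is both the end marker of a word and the mark of a nontrivial swap:    *)
(* the position in a code tells which.                                         *)
Definition symbol : finType := option letter.
Definition blank : symbol := Some letter1.

Fixpoint code S (k : nat) (omega : Omega) (w : word) : seq symbol :=
  if k is k'.+1 then
    (if root_swap w then None else blank) ::
      code S k' (oshift omega) (sections (omega 0) w).1 ++
      code S k' (oshift omega) (sections (omega 0) w).2
  else rcons [seq Some (canon S y) | y <- letters w] None.

Lemma code0 S omega w :
  code S 0 omega w = rcons (map Some (map (canon S) (letters w))) None.
Proof. by rewrite -map_comp. Qed.

Lemma codeS S k omega w : code S k.+1 omega w =
  (if root_swap w then None else blank : symbol) ::
    code S k (oshift omega) (sections (omega 0) w).1 ++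
    code S k (oshift omega) (sections (omega 0) w).2.
Proof. by []. Qed.

Lemma cat_rcons_None_inj (T : eqType) (u u' : seq T) s s' :
  rcons (map Some u) None ++ s = rcons (map Some u') None ++ s' ->
  u = u' /\ s = s'.
Proof.
elim: u u' => [|y u IH] [|y' u'] //=; first by case.
by case=> -> /IH [-> ->].
Qed.

(** The end markers make this a prefix code. Arbitrary tails let the induction split the two
    subtrees, and later absorb padding. *)
Lemma code_inj S k omega w w' s s' : (forall m, omega (k + m) \in S) ->
  code S k omega w ++ s = code S k omega w' ++ s' ->
  word_aut omega w = word_aut omega w' /\ s = s'.
Proof.
elim: k omega w w' s s' => [|k IH] omega w w' s s' omegaS.
  rewrite !code0.
  by case/cat_rcons_None_inj => /(eq_word_aut_canon omegaS) -> ->.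
rewrite [code _ _ _ w]/= [code _ _ _ w']/= !cat_cons -!catA => -[swapE].
case/(IH _ _ _ _ _ omegaS) => eq1 /(IH _ _ _ _ _ omegaS) [eq2 ->]; split=> //.
apply: aut_eqP => -[|i v]; first by case: (asboolW (autP (word_aut omega w))) => _ ->;
  case: (asboolW (autP (word_aut omega w'))).
rewrite !word_aut_cons; congr (_ (+) _ :: _); last by case: i; rewrite ?eq1 ?eq2.
by case: (root_swap w) swapE; case: (root_swap w').
Qed.

Lemma size_code S k omega w :
  (size (code S k omega w)).+1 = nletters k omega w + 2 ^ k.+1.
Proof.
rewrite /nletters; elim: k omega w => [|k IH] omega w.
  by rewrite big_cons big_nil size_rcons size_map; lia.
have := IH (oshift omega) (sections (omega 0) w).1.
have := IH (oshift omega) (sections (omega 0) w).2.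
rewrite big_levelS codeS /= size_cat [2 ^ k.+2]expnS; lia.
Qed.

Lemma count_canon S (u : seq letter) :
  count (fun y => canon S y != letter1) u <=
    \sum_(i in S) count (fun y : letter => ~~ y i) u.
Proof.
elim: u => [|y u IH] /=; first by rewrite big1.
rewrite big_split; apply: leq_add IH; rewrite /canon.
case: ifP => [_|/negbT]; first by rewrite eqxx.
rewrite negb_forall => /existsP [i]; rewrite negb_imply => /andP [iS yi].
by rewrite (bigD1 i) //= yi; case: (_ != _).
Qed.

(** The non-blank symbols are [2 ^ k] end markers, at most [2 ^ k - 1] swaps, and letters vanishing
    somewhere on [S]. *)
Lemma count_code S k omega w :
  count (predC1 blank) (code S k omega w) < \sum_(i in S) nzeros i k omega w + 2 ^ k.+1.
Proof.
rewrite /nzeros; elim: k omega w => [|k IH] omega w.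
  under eq_bigr do rewrite big_cons big_nil addn0.
  rewrite code0 -cats1 count_cat !count_map addn1 expn1 addn2 !ltnS.
  exact: count_canon.
have := IH (oshift omega) (sections (omega 0) w).1.
have := IH (oshift omega) (sections (omega 0) w).2.
rewrite (eq_bigr _ (fun i _ => big_levelS (zeros i) k omega w)).
rewrite big_split codeS /= count_cat.
case: (_ != blank) => /=; rewrite [2 ^ k.+2]expnS; lia.
Qed.

(** * Finding a level with few letters other than [x] *)

Lemma pigeonhole_sum K (F : nat -> nat) : 0 < K ->
  exists r : 'I_K, K * F r <= \sum_(0 <= r < K) F r.
Proof.
move=> K0; exists [arg min_(r < Ordinal K0) F r].
case: arg_minnP => // r _ rmin.
rewrite big_mkord -{1}[K]card_ord -sum_nat_const.
by apply: leq_sum => i _; apply: rmin.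
Qed.

Lemma sum_blocks (F : nat -> nat) N M K :
  \sum_(0 <= r < K) \sum_(N + M * r <= j < N + M * r + M) F j =
    \sum_(N <= j < N + M * K) F j.
Proof.
elim: K => [|K IH]; first by rewrite muln0 addn0 !big_geq.
rewrite big_nat_recr //= IH mulnSr addnA.
by rewrite -big_cat_nat ?leq_addr.
Qed.

(** With [J = N + M * K], the lower bound on [n] gives [2 * 4 ^ J <= n], so the markers and swaps
    stay negligible even after multiplication by [K <= 2 ^ J]. *)
Lemma sparse_code S N M K n omega w :
  (forall k, N <= k -> window omega k M = S) -> 0 < K -> 0 < M ->
  2 ^ (2 * (N + M * K)).+1 <= n -> size (letters w) <= n.+1 ->
  exists r : 'I_K, let c := code S (N + M * r) omega w in
    size c <= 2 * n /\ K * count (predC1 blank) c <= 7 * n.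
Proof.
move=> winS K0 M0 len wn; set J := N + M * K in len *.
have [r /=] := pigeonhole_sum
  (fun r => \sum_(N + M * r <= j < N + M * r + M) nerased j omega w) K0.
rewrite sum_blocks -/J; set T := bigop.body _ _ _ => KT.
exists r; set j := N + M * r.
have jJ : j < J.
  by rewrite /j /J; have := ltn_ord r; nia.
have J2 : 2 * (2 ^ J * 2 ^ J) <= n.
  by apply: leq_trans len; rewrite expnS -expnD addnn -mul2n.
have KJ : K <= 2 ^ J.
  by apply: leq_trans (ltnW (ltn_expl J (ltnSn 1))); rewrite /J; nia.
have jP : 2 ^ j.+1 <= 2 ^ J by rewrite leq_exp2l.
have J_n : 2 * 2 ^ J <= n.
  by have := expn_gt0 2 J; nia.
have Tn : \sum_(N <= j < J) nerased j omega w <= 2 * n.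
  have := nletters_sum J omega w; rewrite expnS.
  rewrite (big_cat_nat (n := N)) ?leq_addr //=.
  by move: wn => /=; lia.
split.
  move: (size_code S j omega w) (nletters_sum j omega w).
  by set c := size _; set l := size _ in wn *; lia.
(* There are at most three symbols in [S]; the final constant is 7 = 3 * 2 + 1, from
   [K * T <= 2 * n] and the markers. *)
have Sz : \sum_(i in S) nzeros i j omega w <= 3 * T.
  apply: (@leq_trans (\sum_(i in S) T)).
    apply: leq_sum => i iS; apply: nzeros_window.
    by rewrite winS // leq_addr.
  by rewrite sum_nat_const leq_mul2r (leq_trans (max_card _)) ?card_ord ?orbT.
have cT : count (predC1 blank) (code S j omega w) <= 3 * T + 2 ^ J.
  have := count_code S j omega w; set c := count _ _; lia.
apply: (leq_trans (leq_mul (leqnn K) cT)); rewrite mulnDr mulnCA.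
have : K * 2 ^ J <= 2 ^ J * 2 ^ J by rewrite leq_mul2r KJ orbT.
lia.
Qed.

(** * Words representing the elements of a ball *)

(** Only [a] lengthens a word: the other generators are spine elements and merge into its rightmost
    letter. *)
Lemma mul_gen_word omega g w : overgroup_gens omega g ->
  exists2 w', size (letters w') <= (size (letters w)).+1
    & word_aut omega w' = (word_aut omega w * g)%g.
Proof.
have spineE (s : nat -> bool) (y : letter) :
    (forall n, s n = y (omega n)) -> spine_aut s = spine omega y.
  by move=> sy; congr spine_aut; apply: funext.
pose lb : letter := [ffun i : 'I_3 => i != 2 :> nat].
pose lc : letter := [ffun i : 'I_3 => i != 1 :> nat].
pose ld : letter := [ffun i : 'I_3 => i != 0 :> nat].
have bE : gen_b omega = spine omega lb by apply: spineE => n; rewrite ffunE.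
have cE : gen_c omega = spine omega lc by apply: spineE => n; rewrite ffunE.
have dE : gen_d omega = spine omega ld by apply: spineE => n; rewrite ffunE.
have xE : gen_x = spine omega letter1 by apply: spineE => n; rewrite ffunE.
have mulP y : g = spine omega y -> exists2 w',
    size (letters w') <= (size (letters w)).+1
    & word_aut omega w' = (word_aut omega w * g)%g.
  move=> ->; exists (mul_letter w y); first exact: leqnSn.
  exact: word_aut_mul_letter.
rewrite /overgroup_gens /= !inE bE cE dE xE -!spineD.
case/orP => [/eqP ->|]; first by exists (mul_a true w) => //; exact: word_aut_mul_a.
by do 6?[case/orP => [/eqP /mulP //|]]; move/eqP/mulP.
Qed.

Lemma products_word omega n g : products (overgroup_gens omega) n g ->
  exists2 w, size (letters w) <= n.+1 & word_aut omega w = g.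
Proof.
move=> [s [sn sS ->]].
suff [w ws ww] : exists2 w, size (letters w) <= (size s).+1
    & word_aut omega w = (\prod_(h <- s) h)%g.
  by exists w => //; apply: leq_trans ws _.
elim/last_ind: s sS {sn} => [|s h IH] sS.
  by exists (letter0, [::]) => //; rewrite big_nil word_aut1.
have [|w ws ww] := IH; first by move=> k ks; apply: sS; rewrite mem_rcons inE ks orbT.
have /(mul_gen_word w) [w' w's w'w] : overgroup_gens omega h.
  by apply: sS; rewrite mem_rcons mem_head.
exists w'; first by rewrite size_rcons; apply: leq_trans w's _.
by rewrite w'w ww -cats1 big_cat big_seq1.
Qed.

(** * Counting sparse codes *)

(* Give the letter x0 weight K and all others weight 1. *)
Lemma card_sparse_ffun (T : finType) (x0 : T) (L K q : nat) : 0 < K ->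
  #|[set f : {ffun 'I_L -> T} | #|[set i | f i != x0]| <= q]| * K ^ L <=
    K ^ q * (K + #|T|.-1) ^ L.
Proof.
move=> K0; pose wt y := if y == x0 then K else 1.
have sum_wt : \sum_y wt y = K + #|T|.-1.
  rewrite (bigD1 x0) //= {1}/wt eqxx; congr (_ + _).
  rewrite (eq_bigr (fun=> 1)) => [|y /negPf]; last by rewrite /wt => ->.
  by rewrite sum1_card cardC1.
have prod_wt (f : {ffun 'I_L -> T}) :
    K ^ L = K ^ #|[set i | f i != x0]| * \prod_i wt (f i).
  have -> : K ^ #|[set i | f i != x0]| = \prod_i (if f i != x0 then K else 1).
    rewrite -big_mkcond prod_nat_const.
    by congr (K ^ _); apply: eq_card => i; rewrite inE.
  rewrite -big_split /= -{1}(card_ord L) -prod_nat_const; apply: eq_bigr => i _.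
  by rewrite /wt; case: eqP; rewrite ?muln1 ?mul1n.
have <- : \prod_(i < L) \sum_y wt y = (K + #|T|.-1) ^ L.
  by rewrite prod_nat_const card_ord sum_wt.
rewrite bigA_distr_bigA /= big_distrr /= -sum_nat_const.
rewrite [leqRHS](bigID (mem [set f : {ffun 'I_L -> T} | #|[set i | f i != x0]| <= q])) /=.
apply: leq_trans (leq_addr _ _); apply: leq_sum => f; rewrite inE => fq.
by rewrite (prod_wt f) leq_mul2r leq_pexp2l ?orbT.
Qed.

(** A relation serves as encoding because a code depends on the word chosen for the group
    element. *)
Lemma card_fset_set_le (T : choiceType) (F : finType) (A : set T) (B : {set F})
    (R : T -> F -> Prop) : finite_set A ->
  (forall x, A x -> exists2 y, y \in B & R x y) ->
  (forall x x' y, R x y -> R x' y -> x = x') ->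
  #|` fset_set A| <= #|B|.
Proof.
move=> finA exR injR.
have /choice [f fP] (x : fset_set A) : exists y, y \in B /\ R (val x) y.
  have := valP x; rewrite in_fset_set // inE => /exR [y yB xy].
  by exists y.
have f_inj : injective f.
  move=> x y fxy; apply/val_inj/(injR _ _ (f x)); first by have [] := fP x.
  by rewrite fxy; have [] := fP y.
rewrite cardfE -(card_imset _ f_inj); apply/subset_leq_card.
by apply/fintype.subsetP => _ /imsetP [x _ ->]; have [] := fP x.
Qed.

Lemma card_nth_count (T : eqType) (x0 : T) (L : nat) (s : seq T) :
  #|[set i : 'I_L | nth x0 s i != x0]| <= count (predC1 x0) s.
Proof.
elim: L s => [|L IH] s; first by rewrite (leq_trans (max_card _)) ?card_ord.
rewrite -sum1dep_card big_mkcond big_ord_recl /=.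
case: s => [|x s] /=.
  by rewrite eqxx big1 // => i _; rewrite nth_nil eqxx.
apply: leq_add; first by case: ifP.
by rewrite -big_mkcond sum1dep_card IH.
Qed.

Lemma growth_le S N M K n omega :
  (forall k, N <= k -> window omega k M = S) -> 0 < K -> 0 < M ->
  2 ^ (2 * (N + M * K)).+1 <= n ->
  growth (overgroup omega) (overgroup_gens omega) n * K ^ (2 * n) <=
    K * K ^ (7 * n %/ K) * (K + 8) ^ (2 * n).
Proof.
move=> winS K0 M0 len; set L := 2 * n; set q := 7 * n %/ K.
set sparse := [set f : {ffun 'I_L -> symbol} | #|[set i | f i != blank]| <= q]%SET.
have symE : #|symbol|.-1 = 8 by rewrite card_option card_ffun card_bool card_ord.
have := card_sparse_ffun blank L q K0; rewrite symE -/sparse => sparse_le.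
suff growth_sparse : growth (overgroup omega) (overgroup_gens omega) n <= K * #|sparse|.
  apply: leq_trans (leq_mul growth_sparse (leqnn _)) _.
  by rewrite -!mulnA leq_mul2l sparse_le orbT.
have -> : K * #|sparse| = #|finset.setX [set: 'I_K]%SET sparse| by rewrite cardsX cardsT card_ord.
(* The block index is recorded too, at the cost of a factor [K]: codes can be compared only at a
   common level. *)
pose R g (p : 'I_K * {ffun 'I_L -> symbol}) := exists w, let c := code S (N + M * p.1) omega w in
  [/\ word_aut omega w = g, size c <= L & forall i, p.2 i = nth blank c i].
apply: (@card_fset_set_le _ _ _ _ R).
- apply: (@sub_finite_set _ _ (products (overgroup_gens omega) n)); first by move=> g [].
  exact/finite_products/finite_overgroup_gens.
- move=> g [_ /products_word [w wn <-]].
  have [r /= [cL cq]] := sparse_code winS K0 M0 len wn.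
  set c := code _ _ _ _ in cL cq.
  exists (r, [ffun i : 'I_L => nth blank c i]); last first.
    by exists w; split=> // i; rewrite ffunE.
  rewrite !inE /= leq_divRL // mulnC; apply: leq_trans cq.
  rewrite leq_mul2l; apply/orP; right.
  apply: leq_trans (card_nth_count blank L c); apply: subset_leq_card.
  by apply/fintype.subsetP => i; rewrite !inE ffunE.
- move=> g g' [r f] [w /= [<- cL cf]] [w' /= [<- c'L c'f]].
  set c := code _ _ _ w in cL cf; set c' := code _ _ _ w' in c'L c'f.
  have omegaS m : omega (N + M * r + m) \in S.
    rewrite -(winS (N + M * r + m)); last by rewrite -addnA leq_addr.
    by apply/imsetP; exists (Ordinal M0); rewrite ?addn0.
  (* Reading past the end yields [blank], so the function only determines the code padded with
     blanks. *)
  suff : c ++ nseq (L - size c) blank = c' ++ nseq (L - size c') blank.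
    by case/(code_inj omegaS).
  apply: (@eq_from_nth _ blank) => [|i]; first by rewrite !size_cat !size_nseq !subnKC.
  rewrite size_cat size_nseq subnKC // => iL.
  have nth_pad (s : seq symbol) : nth blank (s ++ nseq (L - size s) blank) i = nth blank s i.
    rewrite nth_cat nth_nseq if_same; case: ltnP => // si.
    by rewrite nth_default.
  by rewrite !nth_pad -(cf (Ordinal iL)) -(c'f (Ordinal iL)).
Qed.

(** Outside [Omega0] some symbol [s] eventually stops occurring, so a late window with two symbols
    is exactly the complement of [s]. *)
Lemma eventual_window omega : (Omega0_star `|` Omega1_star)%classic omega ->
  exists S N M, 0 < M /\ forall k, N <= k -> window omega k M = S.
Proof.
case=> [[_ [M win]]|[om1 [M win]]].
  exists [set: 'I_3]%SET, 0, M; split=> //.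
  case: M win => // /(_ 0) /setP /(_ ord0); rewrite inE.
  by case/imsetP => -[].
have [s [N sN]] : exists s N, forall n, N <= n -> omega n <> s.
  apply: contrapT => no; apply: om1; left => s N.
  apply: contrapT => no2; apply: no; exists s, N => n Nn ns; apply: no2.
  by exists n.
exists [set~ s]%SET, N, M; split=> [|k Nk].
  case: M win => // /(_ 0); rewrite leqNgt => /negP []; apply: (@leq_ltn_trans 0) => //.
  by rewrite leqn0 cards_eq0; apply/eqP/setP => i; rewrite inE; apply/imsetP => -[[]].
apply/eqP; rewrite eqEcard cardsC1 card_ord win andbT.
apply/fintype.subsetP => _ /imsetP [j _ ->]; rewrite !inE; apply/eqP/sN.
exact: leq_trans Nk (leq_addr _ _).
Qed.

(** * Choice of parameters and asymptotics *)

Import Order.TTheory GRing.Theory Num.Theory.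

(** Here [l] is the binary logarithm of [n]. The bounds keep the blocks within the first [l / 2]
    levels, make [K] at least of order [l], and yield [K <= ln n] through [ln 2 >= 1 / 2]. *)
Lemma block_number N M l : 0 < M -> 16 * (M + N + 1) <= l ->
  exists2 K, 4 <= K & [/\ 2 * (N + M * K) < l, l <= 4 * (M * K) & 2 * K <= l].
Proof.
move=> M0 lM; have K2 := divn_eq ((l.-1) %/ 2 - N) M.
have := ltn_pmod ((l.-1) %/ 2 - N) M0.
set K := (_ - N) %/ M in K2 *; set r := (_ - N) %% M in K2 * => rM.
have KM : K * M + r + N = l.-1 %/ 2 by lia.
have K4 : 4 <= K by rewrite leqNgt; apply/negP => K3; nia.
by exists K => //; split; nia.
Qed.

Local Open Scope classical_set_scope.
Local Open Scope ring_scope.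

Lemma ln2_ge (R : realType) : 1 / 2 <= ln 2 :> R.
Proof.
have := @le_ln1Dx R (- (1 / 2)).
have -> : 1 + - (1 / 2) = 2^-1 :> R by lra.
by rewrite lnV ?posrE //; lra.
Qed.

Lemma ln_ge1 (R : realType) (K : nat) : (4 <= K)%N -> 1 <= ln K%:R :> R.
Proof.
move=> K4; have := ln2_ge R => ln2.
apply: (@le_trans _ _ (ln (2 ^+ 2))); first by rewrite lnXn // mulr2n; lra.
have K4' : 4 <= K%:R :> R by rewrite ler_nat.
by rewrite ler_ln ?posrE //; lra.
Qed.

(** From [K + 8 <= K * expR (8 / K)] the last factor costs an exponent 16 n / K, and [K ^ q.+1]
    costs at most 8 n ln K / K; 24 = 16 + 8 since [ln K >= 1]. *)
Lemma growth_le_expR (R : realType) (g K q n : nat) : (4 <= K <= n)%N ->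
  (q * K <= 7 * n)%N ->
  (g * K ^ (2 * n) <= K * K ^ q * (K + 8) ^ (2 * n))%N ->
  g%:R <= expR (24 * n%:R * ln (K%:R : R) / K%:R) :> R.
Proof.
move=> /andP [K4 Kn] qK gK.
have K0 : 0 < K%:R :> R by rewrite ltr0n; lia.
have ln_K : 1 <= ln (K%:R : R) by exact: ln_ge1.
have KE m : K%:R ^+ m = expR (m%:R * ln (K%:R : R)) :> R.
  by rewrite expRM_natl lnK ?posrE.
have : g%:R * K%:R ^+ (2 * n) <=
    K%:R ^+ q.+1 * (K%:R + 8) ^+ (2 * n) :> R.
  by rewrite exprS -[8]/(8%:R) -natrD -!natrX -!natrM ler_nat.
have K8 : K%:R + 8 <= K%:R * expR (8 / K%:R) :> R.
  have -> : K%:R + 8 = K%:R * (1 + 8 / K%:R) :> R.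
    by rewrite mulrDr mulr1 mulrCA divff ?mulr1 // gt_eqF.
  by rewrite ler_pM2l // expR_ge1Dx.
move=> /le_trans H; have {H} : g%:R * K%:R ^+ (2 * n) <=
    K%:R ^+ q.+1 * (K%:R * expR (8 / K%:R)) ^+ (2 * n) :> R.
  apply: H; rewrite ler_pM2l ?exprn_gt0 //.
  by apply: lerXn2r; rewrite ?nnegrE ?mulr_ge0 ?expR_ge0 ?addr_ge0 // ltW.
rewrite exprMn mulrCA mulrC ler_pM2l ?exprn_gt0 // KE -expRM_natl -expRD.
move=> /le_trans; apply; rewrite ler_expR.
rewrite -ler_pdivrMr ?invr_gt0 // invrK mulrDl.
have q7 : q%:R * K%:R <= 7 * n%:R :> R by rewrite -natrM -(natrM _ 7) ler_nat.
have Kn' : K%:R <= n%:R :> R by rewrite ler_nat.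
rewrite -(mulrA _ (8 / _)) divfK ?gt_eqF // mulrAC natrM -natr1.
have K1 : 1 <= K%:R :> R by rewrite ler1n; lia.
have qn : (q%:R + 1) * K%:R <= 8 * n%:R :> R by lra.
have := ler_wpM2r (ltW (lt_le_trans ltr01 ln_K)) qn.
have := ler_wpM2l (ler0n R n) ln_K.
lra.
Qed.

Theorem theorem2 (R : realType) (omega : Omega)
    (homega : (Omega0_star `|` Omega1_star) omega) :
  preceq (fun n : nat => (growth (overgroup omega) (overgroup_gens omega) n)%:R)
         (fun t : R => expR (t * ln (ln t) / ln t)).
Proof.
have [S [N [M [M0 winS]]]] := eventual_window homega.
(* 384 = 24 * 2 * 8: 24 comes from [growth_le_expR], 2 from ln (B n) <= 2 ln n (as B <= n), and 8
   from ln n <= 8 M K. *)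
exists 1, (384 * M)%:R; split=> //; first by rewrite ltr0n; lia.
exists (2 ^ (16 * (M + N + 1)) + 384 * M)%N => // n /= n_large.
have n0 : (0 < n)%N by lia.
have /andP [ln_ nl] := trunc_log_bounds (ltnSn 1) n0.
set l := trunc_log 2 n in ln_ nl.
have l_large : (16 * (M + N + 1) <= l)%N by apply: trunc_log_max => //; lia.
have [K K4 [NMK lK Kl]] := block_number M0 l_large.
have Kn : (4 <= K <= n)%N.
  by rewrite K4 (leq_trans _ (ltnW (leq_trans (ltn_expl l (ltnSn 1)) ln_))) //; lia.
have len : (2 ^ (2 * (N + M * K)).+1 <= n)%N.
  by apply: leq_trans ln_; rewrite leq_exp2l.
have K0 : (0 < K)%N by lia.
have := growth_le_expR R Kn (leq_divM _ _) (growth_le winS K0 M0 len).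
move=> /le_trans; apply; rewrite mul1r ler_expR.
set x : R := n%:R; set k : R := K%:R.
have ln2_le1 : ln 2 <= 1 :> R.
  have := @le_ln1Dx R 1; have -> : 1 + 1 = 2 :> R by lra.
  by apply; lra.
have n1 : 1 <= x by rewrite ler1n.
have lnn_ub : ln x <= 8 * M%:R * k.
  have : ln x <= ln (2 ^+ l.+1).
    by rewrite ler_ln ?posrE ?exprn_gt0 ?ltr0n // -natrX ler_nat ltnW.
  rewrite lnXn // -(mulr_natl (ln _)) => /le_trans; apply.
  have : l.+1%:R <= 8 * M%:R * k by rewrite -!natrM ler_nat; nia.
  by have := ler_wpM2l (ler0n R l.+1) ln2_le1; lra.
have lnn_lb : k <= ln x.
  have : ln (2 ^+ l) <= ln x.
    by rewrite ler_ln ?posrE ?exprn_gt0 ?ltr0n // -natrX ler_nat.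
  rewrite lnXn // -(mulr_natl (ln _)); apply: le_trans.
  have : 2 * k <= l%:R by rewrite -natrM ler_nat.
  by have := ler_wpM2l (ler0n R l) (ln2_ge R); lra.
have lnk1 : 1 <= ln k by apply: ln_ge1.
have k0 : 0 < k by rewrite ltr0n.
have lnx0 : 0 < ln x by lra.
have lnlnx : ln k <= ln (ln x) by rewrite ler_ln ?posrE.
set B : R := (384 * M)%:R.
have B1 : 1 <= B by rewrite ler1n; lia.
have Bx : B <= x by rewrite ler_nat; lia.
have lnBx : ln (B * x) <= 2 * ln x.
  rewrite lnM ?posrE; [|lra..].
  have : ln B <= ln x by rewrite ler_ln ?posrE; lra.
  lra.
have lnBx_lb : ln x <= ln (B * x).
  by rewrite ler_ln ?posrE ?mulr_gt0; try lra; nra.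
have lnlnBx : ln (ln x) <= ln (ln (B * x)) by rewrite ler_ln ?posrE; lra.
rewrite ler_pdivrMr // [leRHS]mulrAC ler_pdivlMr; last lra.
have BE : B = 384 * M%:R by rewrite /B natrM.
have M1 : 1 <= M%:R :> R by rewrite ler1n.
apply: (@le_trans _ _ (24 * x * ln k * (2 * (8 * M%:R * k)))).
  by apply: ler_wpM2l; rewrite ?mulr_ge0; lra.
have -> : 24 * x * ln k * (2 * (8 * M%:R * k)) = B * x * ln k * k by rewrite BE; ring.
by rewrite ler_wpM2r ?ler_wpM2l ?mulr_ge0; lra.
Qed.
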